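(* Let $T=[0,T_0]$ for some $T_0>0$ or $T=[0,\infty)$, and let $(u,\beta)$ and $(v,\gamma)$ be solutions to mass-conserving double-obstacle AC flow on $T$ with $u(0)=v(0)$. Then $u(t)=v(t)$ for all $t\in T$, and there exists $\tilde T\subseteq T$ with $T\setminus\tilde T$ of Lebesgue measure zero such that for all $t\in\tilde T$, $\beta(t)-\gamma(t)=(\overline{\beta(t)}-\overline{\gamma(t)})\mathbf 1$. Furthermore, if $u_i(t)\in(0,1)$ for some $i\in V$ and $t\in\tilde T$, then $\beta(t)=\gamma(t)$.
   Context: $G=(V,E)$ is a finite, simple, connected, undirected graph with weights $\omega_{ij}=\omega_{ji}>0$ for $ij\in E$, $\omega_{ij}=0$ otherwise; $d_i=\sum_j\omega_{ij}$, $r\in[0,1]$ fixed. $\mathcal V$ = functions $V\to\mathbb R$ with $\langle u,v\rangle_{\mathcal V}=\sum_i u_iv_id_i^r$; $\mathcal V_X$ = functions $V\to X$. $(\Delta u)_i=d_i^{-r}\sum_j\omega_{ij}(u_i-u_j)$. $\mathbf 1$ all-ones; $\mathcal M(u)=\langle u,\mathbf 1\rangle_{\mathcal V}$; $\bar v=\mathcal M(v)/\mathcal M(\mathbf 1)$. $\varepsilon>0$. For $u\in\mathcal V_{[0,1]}$, $\mathcal B(u)$ = set of $\beta\in\mathcal V$ with $\beta_i\ge0$ if $u_i=0$, $\beta_i=0$ if $0<u_i<1$, $\beta_i\le0$ if $u_i=1$; $\mathcal B(u)=\emptyset$ otherwise. $H^1_{loc}(T;\mathcal V)$: functions $T\to\mathcal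 V$ whose components lie in $H^1((a,b))$ for all $a,b\in T$, with weak derivative $du/dt$. A pair $(u,\beta)$ with $u:T\to\mathcal V_{[0,1]}$, $\beta:T\to\mathcal V$ is a solution to mass-conserving double-obstacle AC flow on $T$ if $u\in H^1_{loc}(T;\mathcal V)\cap C^0(T;\mathcal V)$ and for a.e. $t\in T$: $\varepsilon \frac{du}{dt} + \varepsilon\Delta u(t)-u(t)+\overline{u(t)}\mathbf{1} = \beta(t) - \overline{\beta(t)}\mathbf{1}$ and $\beta(t)\in\mathcal B(u(t))$. *)

(* Defs.v *)
From HB Require Import structures.
From mathcomp Require Import all_boot all_order all_algebra.
From mathcomp Require Import all_classical all_reals all_analysis.
Set Implicit Arguments. Unset Strict Implicit. Unset Printing Implicit Defensive.
Import Order.TTheory GRing.Theory Num.Theory.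
Import numFieldNormedType.Exports.
Local Open Scope classical_set_scope.
Local Open Scope ring_scope.

Section Graph.
Variables (R : realType) (V : finType) (w : V -> V -> R) (r : R).

Definition deg (i : V) : R := \sum_(j : V) w i j.

Definition glap (u : V -> R) (i : V) : R :=
  (deg i `^ r)^-1 * \sum_(j : V) w i j * (u i - u j).

Definition gmass (u : V -> R) : R := \sum_(i : V) u i * deg i `^ r.

Definition gbar (u : V -> R) : R := gmass u / gmass (fun _ => 1).

Definition inB (u beta : V -> R) : Prop :=
  forall i, [/\ 0 <= u i <= 1,
               (u i = 0 -> 0 <= beta i),
               (0 < u i < 1 -> beta i = 0) &
               (u i = 1 -> beta i <= 0)].

End Graph.

Section Sobolev.
Variable R : realType.

Definition test_fun (a b : R) (phi : R -> R) : Prop :=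
  (forall (n : nat) (x : R), derivable (derive1n n phi) x 1) /\
  exists c d : R, [/\ a < c, c <= d, d < b &
                      forall x, (x < c \/ d < x) -> phi x = 0].

Definition L2_on (a b : R) (f : R -> R) : Prop :=
  measurable_fun `]a, b[ f /\
  (@lebesgue_measure R).-integrable `]a, b[ (fun x => ((f x) ^+ 2)%:E).

Definition H1_with_deriv (a b : R) (f g : R -> R) : Prop :=
  [/\ L2_on a b f, L2_on a b g &
      forall phi, test_fun a b phi ->
        (\int[@lebesgue_measure R]_(x in `]a, b[) (f x * derive1 phi x)%:E =
         - \int[@lebesgue_measure R]_(x in `]a, b[) (g x * phi x)%:E)%E].

End Sobolev.

Section Flow.
Variables (R : realType) (V : finType) (w : V -> V -> R) (r eps : R).

Definition mcDOAC_solution (T : set R) (u beta : R -> V -> R) : Prop :=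
  [/\ (forall t, T t -> forall i, 0 <= u t i <= 1),
      (forall i, {within T, continuous (fun t => u t i)}) &
      (* u in H^1_loc(T; V) with weak derivative du, and the equation a.e. *)
      exists du : R -> V -> R,
        (forall a b, T a -> T b -> forall i,
           H1_with_deriv a b (fun t => u t i) (fun t => du t i)) /\
        {ae @lebesgue_measure R, forall t, T t ->
           (forall i, eps * du t i + eps * glap w r (u t) i - u t i
                      + gbar w r (u t)
                      = beta t i - gbar w r (beta t)) /\
           inB (u t) (beta t)}].

End Flow.

(* Main.v *)
(** The difference [f = u - v] satisfies
      [eps f' + eps Lap f - f + bar f = delta - bar delta],
    with [delta = beta - gamma] and [f_i delta_i <= 0] by monotonicity of the
    obstacle subdifferential. Summing against the weights [d_i^r] shows that the
    mass of [f] is constant, hence 0; testing with [f] and using the positivity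
    of the Dirichlet form then gives [(|f|^2)' <= (2/eps) |f|^2], and Gronwall's
    inequality yields [f = 0]. The weak derivatives therefore agree almost
    everywhere, and so do [beta - bar beta] and [gamma - bar gamma].

    Weak derivatives are turned into increments, [f t - f s = int_s^t g], by
    testing against smooth approximations of the indicator of [(s, t]], built
    from [exp(-1/x)]. *)

Require Import Defs.
From HB Require Import structures.
From mathcomp Require Import all_boot all_order all_algebra.
From mathcomp Require Import all_classical all_reals all_analysis.
From mathcomp Require Import measurable_realfun ring lra.
Import Order.TTheory GRing.Theory Num.Theory.
Import numFieldNormedType.Exports.
Local Open Scope classical_set_scope.
Local Open Scope ring_scope.

(** * A smooth step function *)

Section SmoothStep.
Context {R : realType}.
Implicit Types f g : R -> R.

(** Each derivative is carried as an explicit witness, so closure under sums, products, inverses and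
    affine substitution goes by induction on [n], without computing iterated derivatives. *)
Fixpoint ndiff (n : nat) f : Prop :=
  if n is m.+1 then exists2 f' : R -> R, (forall x : R, is_derive x (1 : R) f (f' x)) &
      ndiff m f'
  else True.

Definition smooth f := forall n, ndiff n f.

Lemma ndiffW n f : ndiff n.+1 f -> ndiff n f.
Proof.
elim: n f => [//|n IHn] f [f' ff' f'n].
by exists f' => //; exact: IHn.
Qed.

Lemma ndiff_cst n (c : R) : ndiff n (cst c).
Proof.
elim: n c => [//|n IHn] c; exists (cst 0) => // x; exact: is_derive_cst.
Qed.

Lemma ndiffD n f g : ndiff n f -> ndiff n g -> ndiff n (f \+ g).
Proof.
elim: n f g => [//|n IHn] f g [f' ff' f'n] [g' gg' g'n].
by exists (f' \+ g'); [move=> x; exact: is_deriveD | exact: IHn].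
Qed.

Lemma ndiffM n f g : ndiff n f -> ndiff n g -> ndiff n (f \* g).
Proof.
elim: n f g => [//|n IHn] f g fn gn.
have [f' ff' f'n] := fn; have [g' gg' g'n] := gn.
exists ((f \* g') \+ (g \* f')).
  by move=> x; exact: is_deriveM.
by apply: ndiffD; apply: IHn => //; exact: ndiffW.
Qed.

(** The derivative [- f^-1 * f^-1 * f'] contains the inverse itself only one order lower, where the
    induction hypothesis covers it. *)
Lemma ndiffV n f : (forall x, f x != 0) -> ndiff n f -> ndiff n (fun x => (f x)^-1).
Proof.
move=> f0; elim: n => [//|n IHn] fn; have [f' ff' f'n] := fn.
exists ((cst (-1) \* (fun x => (f x)^-1)) \* ((fun x => (f x)^-1) \* f')).
  move=> x; have := @is_deriveV _ _ x (f' x) 1 (f0 x) (ff' x).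
  move=> h; apply: is_derive_eq; rewrite /= /GRing.scale /= -exprVn.
  ring.
apply: ndiffM; apply: ndiffM => //; (apply: IHn || exact: ndiff_cst).
  exact: ndiffW.
exact: ndiffW.
Qed.

Lemma is_derive_affine f (a b d x : R) :
  is_derive (a * x + b) (1 : R) f d ->
  is_derive x (1 : R) (fun y => f (a * y + b)) (a * d).
Proof.
move=> fd; have h : is_derive x 1 (fun y : R => a * y + b) a.
  have h1 : is_derive x 1 (fun y : R => a * y) a.
    have := @is_deriveZ _ _ _ id a x 1 1 (is_derive_id _ _).
    by move=> h1; apply: is_derive_eq; rewrite /GRing.scale /= mulr1.
  have := @is_deriveD _ _ _ _ _ x 1 a 0 h1 (is_derive_cst b x 1).
  by rewrite addr0.
by rewrite mulrC; exact: (@is_derive1_comp _ f _ x d a).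
Qed.

Lemma ndiff_affine n f (a b : R) : ndiff n f -> ndiff n (fun x => f (a * x + b)).
Proof.
elim: n f => [//|n IHn] f [f' ff' f'n].
exists (cst a \* (fun x => f' (a * x + b))).
  by move=> x; exact: is_derive_affine.
by apply: ndiffM; [exact: ndiff_cst | exact: IHn].
Qed.

Lemma smooth_derivable_derive1n f : smooth f ->
  forall n x, derivable (derive1n n f) x 1.
Proof.
move=> sf n; move: (sf n.+1) => {sf}.
elim: n f => [|n IHn] f [f' ff' f'n] x.
  by have := ff' x => -[].
rewrite /derive1n iterSr; have -> : derive1 f = f'.
  by apply/funext => y; have ffy := ff' y; rewrite derive1E derive_val.
exact: IHn.
Qed.

(** The exponential series gives [y ^+ i <= i! * expR y] for [y >= 0]; summing over the coefficients
    yields the constant. *)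
Lemma horner_expRN_bounded (p : {poly R}) :
  exists C, forall y, 0 <= y -> `|p.[y]| * expR (- y) <= C.
Proof.
exists (\sum_(i < size p) `|p`_i| * i`!%:R) => y y0.
rewrite horner_coef.
apply: (@le_trans _ _ ((\sum_(i < size p) `|p`_i * y ^+ i|) * expR (- y))).
  by rewrite ler_wpM2r ?expR_ge0// ler_norm_sum.
rewrite mulr_suml; apply: ler_sum => i _; rewrite normrM -mulrA ler_wpM2l//.
rewrite expRN ler_pdivrMr ?expR_gt0// ger0_norm ?exprn_ge0//.
case: (nat_of_ord i) => [|k].
  by rewrite expr0 fact0 mul1r -expR0 ler_expR.
have := expR_ge1Dxn k y0.
move=> h; rewrite mulrC -ler_pdivrMr ?ltr0n ?fact_gt0//.
by rewrite (le_trans _ h)// lerDr.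
Qed.

(* The family [p(1/x) exp(-1/x)], extended by 0 to [x <= 0], is stable under
   differentiation, so all its members are smooth. *)
Definition expinv (p : {poly R}) (x : R) : R :=
  if 0 < x then p.[x^-1] * expR (- x^-1) else 0.

Lemma is_derive_expinv (p : {poly R}) (x : R) :
  is_derive x 1 (expinv p) (expinv ('X^2 * (p - p^`())) x).
Proof.
have [x0|x0|<-] := ltrgtP 0 x.
- rewrite {2}/expinv x0.
  apply: (@near_eq_is_derive _ _ _ (fun x : R => p.[x^-1] * expR (- x^-1))).
  + near=> y; rewrite /expinv ifT//; near: y.
    exact: lt_nbhsr.
  have x0' : x != 0 by rewrite gt_eqF.
  have dV : is_derive x 1 (fun x : R => x^-1) (- x ^- 2).
    have := @is_deriveV _ id x 1 1 x0' (is_derive_id _ _) => h.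
    by apply: is_derive_eq; rewrite /GRing.scale /= mulr1.
  have dp := @is_derive1_comp _ (horner p) (fun x => x^-1) x _ _ (is_derive_poly p _) dV.
  have dNV := @is_deriveN _ _ _ _ x 1 _ dV.
  have de := @is_derive1_comp _ expR (fun x => - x^-1) x _ _ (is_derive_expR _) dNV.
  have := @is_deriveM _ _ _ _ x 1 _ _ dp de => h; apply: is_derive_eq.
  rewrite /GRing.scale /= !hornerE /= -exprVn.
  ring.
- rewrite {2}/expinv ltNge (ltW x0) /=.
  apply: (@near_eq_is_derive _ _ _ (cst 0)).
  + near=> y; rewrite /expinv ifF//; apply/negbTE; rewrite -leNgt ltW//; near: y.
    exact: lt_nbhsl.
- rewrite {2}/expinv ltxx.
  suff h : h^-1 *: (expinv p (h *: 1 + 0) - expinv p 0) @[h --> (0:R)^'] --> (0:R).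
    by apply: DeriveDef; [apply/cvg_ex; exists 0|apply/cvg_lim].
  (* For [h > 0] the difference quotient at 0 equals [h] times [expinv ('X^2 * p) h], whose second
     factor is bounded by [C]; so it tends to 0. *)
  have [C hC] := horner_expRN_bounded ('X^2 * p).
  have C0 : 0 <= C.
    by apply: le_trans (hC 0 (lexx _)); rewrite mulr_ge0 ?expR_ge0.
  apply/cvgrPdist_le => e e0; near=> h.
  rewrite sub0r normrN addr0 {2}/expinv ltxx subr0 /GRing.scale /= mulr1 /expinv.
  case: ifPn => [h0|]; last by rewrite mulr0 normr0 ltW.
  have := hC h^-1; rewrite invr_ge0 (ltW h0) => /(_ isT).
  rewrite !hornerE /= !normrM (ger0_norm (expR_ge0 _)) => Ch.
  apply: (@le_trans _ _ (h * C)).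
    rewrite -ler_pdivrMl// (le_trans _ Ch)// !mulrA.
    by rewrite (ger0_norm (_ : 0 <= h^-1))// invr_ge0 ltW.
  apply: (@le_trans _ _ (h * (C + 1))); first by rewrite ler_wpM2l ?(ltW h0)// lerDl.
  rewrite -ler_pdivlMr ?ltr_pwDr//.
  apply: le_trans (ler_norm _) _; near: h; apply: dnbhs0_le.
  by rewrite divr_gt0// ltr_pwDr.
Unshelve. all: by end_near. Qed.

Lemma ndiff_expinv n p : ndiff n (expinv p).
Proof.
elim: n p => [//|n IHn] p.
by exists (expinv ('X^2 * (p - p^`()))); first exact: is_derive_expinv.
Qed.

Definition bump (x : R) : R := expinv 1 x.

(** The standard smooth transition from 0 on [x <= 0] to 1 on [x >= 1]. The denominator never
    vanishes because [x] and [1 - x] are not both nonpositive. *)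
Definition smooth_step (x : R) : R := bump x / (bump x + bump (1 - x)).

Lemma bump_gt0 x : 0 < x -> 0 < bump x.
Proof. by move=> x0; rewrite /bump /expinv x0 hornerC mul1r expR_gt0. Qed.

Lemma bump_le0 x : x <= 0 -> bump x = 0.
Proof. by move=> x0; rewrite /bump /expinv ltNge x0. Qed.

Lemma bump_ge0 x : 0 <= bump x.
Proof.
by have [x0|x0] := ltP 0 x; [rewrite ltW ?bump_gt0 | rewrite bump_le0].
Qed.

Lemma bump_den_gt0 x : 0 < bump x + bump (1 - x).
Proof.
have [x0|x0] := ltP 0 x; first by rewrite ltr_pwDl ?bump_gt0 ?bump_ge0.
by rewrite ltr_wpDl ?bump_ge0// bump_gt0// subr_gt0 (le_lt_trans x0).
Qed.

Lemma smooth_step_le0 x : x <= 0 -> smooth_step x = 0.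
Proof. by move=> x0; rewrite /smooth_step bump_le0// mul0r. Qed.

Lemma smooth_step_ge1 x : 1 <= x -> smooth_step x = 1.
Proof.
move=> x1; rewrite /smooth_step (@bump_le0 (1 - x)) ?subr_le0// addr0 divff//.
by rewrite gt_eqF// bump_gt0// (lt_le_trans _ x1).
Qed.

Lemma smooth_step_itv x : 0 <= smooth_step x <= 1.
Proof.
rewrite divr_ge0 ?bump_ge0 ?(ltW (bump_den_gt0 x))//=.
by rewrite ler_pdivrMr ?bump_den_gt0// mul1r lerDl bump_ge0.
Qed.

Lemma smooth_smooth_step : smooth smooth_step.
Proof.
move=> n; have bn : ndiff n bump by exact: ndiff_expinv.
apply: ndiffM => //; apply: ndiffV.
  by move=> x; rewrite gt_eqF// bump_den_gt0.
apply: ndiffD => //; have := ndiff_affine n bump (-1) 1 bn.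
congr (ndiff n _); apply/funext => x; congr bump; ring.
Qed.

End SmoothStep.

(** * Weak derivatives and the fundamental theorem of calculus *)

Section WeakDerivative.
Context {R : realType}.
Notation mu := (@lebesgue_measure R).

(** The step is locally constant off [[0, 1]], so its derivative vanishes there; on [[0, 1]] the
    continuous function [|k|] attains its maximum, which bounds it everywhere. *)
Lemma smooth_step_deriv : exists (k : R -> R) (C : R),
  [/\ forall x : R, is_derive x (1 : R) smooth_step (k x),
      continuous k,
      forall x, `|k x| <= C &
      forall x, (x < 0 \/ 1 < x) -> k x = 0].
Proof.
have [k dk [k' dk' _]] := @smooth_smooth_step R 2.
have ck : continuous k.
  move=> x; apply: differentiable_continuous; apply/derivable1_diffP.
  by have := dk' x => -[].
have k0 x : (x < 0 \/ 1 < x) -> k x = 0.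
  move=> x01; have dkx := dk x; rewrite -(@derive_val _ _ _ _ _ _ _ dkx).
  have [c hc] : exists c, \near x, smooth_step x = cst c x.
    case: x01 => [x0|x1]; [exists 0|exists 1].
      by near=> y; rewrite smooth_step_le0// ltW//; near: y; exact: lt_nbhsl.
    by near=> y; rewrite smooth_step_ge1// ltW//; near: y; exact: lt_nbhsr.
  by rewrite (near_eq_derive _ hc) derive_cst.
have [||c _ hc] := @EVT_max R (fun x => `|k x|) 0 1 => //.
  apply: continuous_subspaceT => x; apply: continuous_comp; first exact: ck.
  exact: norm_continuous.
exists k, `|k c|; split=> // x.
have [x0|x0] := ltP x 0; first by rewrite k0 ?normr0//; left.
have [x1|x1] := ltP 1 x; first by rewrite k0 ?normr0//; right.
by apply: hc; rewrite in_itv/= x0.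
Unshelve. all: by end_near. Qed.

Lemma subset_itv_oc_oo (a b s t : R) : a < s -> t < b ->
  `]s, t]%classic `<=` `]a, b[%classic.
Proof.
move=> as_ tb x; rewrite /= !in_itv/= => /andP[sx xt].
by rewrite (lt_trans as_ sx) (le_lt_trans xt tb).
Qed.

Lemma lebesgue_measure_itv_lty (b0 b1 : bool) (a b : R) :
  (mu [set` Interval (BSide b0 a) (BSide b1 b)] < +oo)%E.
Proof.
by rewrite lebesgue_measure_itv/=; case: ifPn => // _; rewrite -EFinB ltry.
Qed.

(** On a bounded interval constants are integrable, and [|f| <= 1 + f ^+ 2]. *)
Lemma L2_on_integrable (a b : R) (f : R -> R) : L2_on a b f ->
  mu.-integrable `]a, b[ (EFin \o f).
Proof.
move=> [mf f2].
have h : mu.-integrable `]a, b[ (fun x => (1 + (f x) ^+ 2)%:E).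
  have mI : measurable (`]a, b[%classic : set R) by [].
  apply: (@integrableD _ _ _ mu _ mI (EFin \o cst 1) (fun x => ((f x) ^+ 2)%:E)) => //.
  apply: measurable_bounded_integrable => //.
    exact: lebesgue_measure_itv_lty.
  exact: bounded_cst.
apply: le_integrable h => //.
- exact/measurable_EFinP.
- move=> x _; rewrite /= lee_fin.
  rewrite [leRHS]ger0_norm; last by rewrite addr_ge0// sqr_ge0.
  rewrite -real_normK ?num_real//.
  have := sqr_ge0 (`|f x| - 1); rewrite sqrrB1; nra.
Qed.

Lemma integrable_mul_bounded (a b : R) (f h : R -> R) (M : R) :
  mu.-integrable `]a, b[ (EFin \o f) -> measurable_fun `]a, b[ h ->
  (forall x, `|h x| <= M) ->
  mu.-integrable `]a, b[ (EFin \o (fun x => f x * h x)).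
Proof.
move=> fi mh hM.
have := @integrableMl _ _ _ mu `]a, b[%classic _ (EFin \o f) h fi mh.
apply => //; exists M; split; rewrite ?num_real // => x Mx y _ /=.
exact: le_trans (hM y) (ltW Mx).
Qed.

(** * One-sided approximate identities from the derivative of the step *)

Section Mollifier.
Variables (k : R -> R) (C : R).
Hypothesis dk : forall x : R, is_derive x (1 : R) smooth_step (k x).
Hypothesis ck : continuous k.
Hypothesis kC : forall x, `|k x| <= C.
Hypothesis k0 : forall x, (x < 0 \/ 1 < x) -> k x = 0.

(** The derivative of the step rescaled to climb on [[y, y + n.+1%:R^-1]]: a kernel of unit mass,
    concentrated just to the right of [y]. *)
Definition mollifier (n : nat) (y x : R) : R := n.+1%:R * k (n.+1%:R * (x - y)).

Lemma is_derive_scaled_step (n : nat) (y x : R) :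
  is_derive x (1 : R) (fun x => smooth_step (n.+1%:R * (x - y))) (mollifier n y x).
Proof.
have := @is_derive_affine R smooth_step n.+1%:R (- (n.+1%:R * y)) _ x (dk _).
rewrite /mollifier mulrBr.
by under eq_fun do rewrite -mulrBr.
Qed.

Lemma continuous_mollifier n y : continuous (mollifier n y).
Proof.
move=> x; apply: cvgM; first exact: cvg_cst.
apply: (@cvg_comp _ _ _ (fun x => n.+1%:R * (x - y)) k); last exact: ck.
by apply: cvgM; [exact: cvg_cst | apply: cvgB; [exact: cvg_id|exact: cvg_cst]].
Qed.

Lemma mollifier_bound n y x : `|mollifier n y x| <= n.+1%:R * C.
Proof. by rewrite normrM ger0_norm// ler_wpM2l. Qed.

Lemma mollifier_out n y x : (x < y \/ y + n.+1%:R^-1 < x) -> mollifier n y x = 0.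
Proof.
move=> h; rewrite /mollifier k0 ?mulr0//.
case: h => h; [left|right].
  by rewrite pmulr_rlt0 ?ltr0n// subr_lt0.
by rewrite -ltr_pdivrMl ?ltr0n// mulr1 ltrBrDl.
Qed.

Lemma integral_mollifier n y :
  \int[mu]_(x in `[y, y + n.+1%:R^-1]) mollifier n y x = 1.
Proof.
have m0 : (0 : R) < n.+1%:R by rewrite ltr0n.
rewrite /Rintegral.
pose F x := @smooth_step R (n.+1%:R * (x - y)).
have cF : continuous F.
  move=> x; apply: differentiable_continuous; apply/derivable1_diffP.
  by have := is_derive_scaled_step n y x => -[].
rewrite (@continuous_FTC2 _ _ F).
- rewrite /F subrr mulr0 (@smooth_step_le0 _ 0)// addrAC subrr add0r divff ?gt_eqF//.
  by rewrite smooth_step_ge1// sube0.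
- by rewrite ltrDl invr_gt0.
- by apply: continuous_subspaceT; exact: continuous_mollifier.
- split.
  + by move=> x _; have := is_derive_scaled_step n y x => -[].
  + exact/cvg_at_right_filter/cF.
  + exact/cvg_at_left_filter/cF.
- move=> x _; have := is_derive_scaled_step n y x => d.
  by rewrite derive1E derive_val.
Qed.

(** The kernel has unit mass, is bounded by [m * C] with [m = n.+1], and lives on an interval of
    length [m^-1]. Once [f] varies by at most [e / (C + 1)] there, the error is at most
    [e * C / (C + 1)]. *)
Lemma mollifier_cvg (a b y : R) (f : R -> R) : a < y -> y < b ->
  {for y, continuous f} -> mu.-integrable `]a, b[ (EFin \o f) ->
  \int[mu]_(x in `]a, b[) (f x * mollifier n y x) @[n --> \oo] --> f y.
Proof.
move=> ay yb cf fi; have C0 : 0 <= C by apply: le_trans (kC 0).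
have C1 : 0 < C + 1 by rewrite ltr_pwDr.
apply/cvgrPdist_le => e e0.
have [d /= d0 hd] : \forall d \near (0 : R)^'+, forall x, y <= x <= y + d ->
    [/\ a < x, x < b & `|f x - f y| <= e / (C + 1)].
  have /cvgrPdist_le/(_ (e / (C + 1))) := cf.
  rewrite divr_gt0// => /(_ isT) [d /= d0 hd].
  near=> d'.
  move=> x /andP[yx xy]; split; first exact: lt_le_trans yx.
    apply: le_lt_trans xy _; rewrite -ltrBrDl; near: d'.
    by apply: nbhs_right_lt; rewrite subr_gt0.
  rewrite distrC; apply: hd => /=; rewrite distrC ger0_norm ?subr_ge0//.
  rewrite ltrBlDl; apply: le_lt_trans xy _; rewrite ltrD2l; near: d'.
  exact: nbhs_right_lt.
near=> n.
have nd : (n.+1%:R : R)^-1 < d.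
  by near: n; exact: near_infty_natSinv_lt (PosNum d0).
set m : R := n.+1%:R; have m0 : 0 < m by rewrite ltr0n.
have {}hd x : y <= x <= y + m^-1 -> [/\ a < x, x < b & `|f x - f y| <= e / (C + 1)].
  apply: hd; rewrite /= ?invr_gt0//.
  by rewrite sub0r normrN ger0_norm ?invr_ge0 ?(ltW m0).
pose I := `[y, y + m^-1]%classic.
have mI : measurable I by exact: measurable_itv.
have Iab : I `<=` `]a, b[.
  by move=> x; rewrite /I /= !in_itv/= => /hd[-> ->].
have Iout x : ~ I x -> mollifier n y x = 0.
  move=> nI; apply: mollifier_out.
  have [xy|xy] := ltP x y; [by left|right].
  by rewrite ltNge; apply/negP => xm; apply: nI; rewrite /I/= in_itv/= xy.
have mm D : measurable_fun D (mollifier n y).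
  by apply: measurable_funTS; apply: continuous_measurable_fun; exact: continuous_mollifier.
have fmi := @integrable_mul_bounded a b f _ _ fi (mm _) (mollifier_bound n y).
have -> : \int[mu]_(x in `]a, b[) (f x * mollifier n y x) =
    \int[mu]_(x in I) (f x * mollifier n y x).
  rewrite Rintegral_mkcond [RHS]Rintegral_mkcond; congr Rintegral.
  apply/funext => x; rewrite !patchE; case: ifPn => xab; case: ifPn => xI //.
    by rewrite Iout ?mulr0// => /mem_set; rewrite (negbTE xI).
  by move: xab; rewrite mem_set//; apply: Iab; exact: set_mem.
have fmiI : mu.-integrable I (EFin \o (fun x => f x * mollifier n y x)).
  exact: integrableS fmi.
have fini : (mu I < +oo)%E by exact: lebesgue_measure_itv_lty.
have mi : mu.-integrable I (EFin \o mollifier n y).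
  apply: measurable_bounded_integrable => //; first exact: mm.
  exists (m * C); split; rewrite ?num_real // => x mx z _ /=.
  exact: le_trans (mollifier_bound n y z) (ltW mx).
have cmi : mu.-integrable I (EFin \o (fun x => f y * mollifier n y x)).
  by have := @integrableZl _ _ _ mu I mI (f y) _ mi.
(* Unit mass writes [f y] as an integral against the same kernel, so that the error becomes the
   integral of a difference. *)
have -> : f y = \int[mu]_(x in I) (f y * mollifier n y x).
  by rewrite RintegralZl// integral_mollifier mulr1.
have dmi : mu.-integrable I
    (EFin \o (fun x => f y * mollifier n y x - f x * mollifier n y x)).
  exact: (@integrableB _ _ _ mu I mI _ _ cmi fmiI).
rewrite -RintegralB//.
apply: le_trans (le_normr_Rintegral _ _) _ => //.
have muI : fine (mu I) = m^-1.
  rewrite /I lebesgue_measure_itv/= lte_fin ltrDl invr_gt0 m0 -EFinB /=.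
  by rewrite addrAC subrr add0r.
apply: (@le_trans _ _ (\int[mu]_(x in I) (e / (C + 1) * (m * C)))).
  apply: le_Rintegral => //.
  - exact: integrable_norm.
  - by apply: measurable_bounded_integrable => //; exact: bounded_cst.
  - move=> x; rewrite /I/= in_itv/= => /hd[_ _ hx].
    rewrite -mulrBl normrM distrC ler_pM//.
    exact: mollifier_bound.
rewrite Rintegral_cst// muI.
have -> : e / (C + 1) * (m * C) * m^-1 = e * (C / (C + 1)).
  by field; rewrite !gt_eqF.
by rewrite ler_piMr ?(ltW e0)// ler_pdivrMr// mul1r lerDl.
Unshelve. all: by end_near. Qed.

End Mollifier.
End WeakDerivative.

(** * Increments of a continuous function as integrals of its weak derivative *)

Section WeakDerivativeFTC.
Context {R : realType}.
Notation mu := (@lebesgue_measure R).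

(** Both ramps lie to the right of their base points, so the pointwise limit is the indicator of
    []s, t]], and the support stays within [[s, t + n.+1%:R^-1]]. *)
Definition smooth_indicator (n : nat) (s t x : R) : R :=
  smooth_step (n.+1%:R * (x - s)) - smooth_step (n.+1%:R * (x - t)).

Lemma smooth_indicator_test_fun (a b s t : R) (n : nat) :
  a < s -> s < t -> t + n.+1%:R^-1 < b -> test_fun a b (smooth_indicator n s t).
Proof.
move=> as_ st tb; split.
  apply: smooth_derivable_derive1n => k.
  have scaled y : ndiff k (fun x : R => smooth_step (n.+1%:R * (x - y))).
    have := ndiff_affine k smooth_step n.+1%:R (- (n.+1%:R * y)) (smooth_smooth_step k).
    by under eq_fun do rewrite -mulrBr.
  have := ndiffD k _ _ (scaled s) (ndiffM k _ _ (ndiff_cst k (-1)) (scaled t)).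
  congr (ndiff k _); apply/funext => x; rewrite /smooth_indicator /=; ring.
have m0 : (0 : R) < n.+1%:R by rewrite ltr0n.
exists s, (t + n.+1%:R^-1); split => //.
  by rewrite ler_wpDr ?invr_ge0// ltW.
move=> x [xs|tx]; rewrite /smooth_indicator.
  rewrite !smooth_step_le0 ?subrr// pmulr_rle0// subr_le0 ltW//.
  exact: lt_trans st.
rewrite !smooth_step_ge1 ?subrr//; rewrite -ler_pdivrMl// mulr1 lerBrDl ltW//.
by rewrite (le_lt_trans _ tx)// lerD2r ltW.
Qed.

Lemma smooth_indicator_le1 n s t x : `|smooth_indicator n s t x| <= 1.
Proof.
have := smooth_step_itv (n.+1%:R * (x - s)).
have := smooth_step_itv (n.+1%:R * (x - t)).
by rewrite /smooth_indicator ler_norml; lra.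
Qed.

Lemma near_natSinv_lt (e : R) : 0 < e -> \forall n \near \oo, n.+1%:R^-1 < e.
Proof. by move=> e0; exact: (near_infty_natSinv_lt (PosNum e0)). Qed.

Lemma smooth_step_scaled_cvg (y x : R) :
  smooth_step (n.+1%:R * (x - y)) @[n --> \oo] --> ((y < x)%R%:R : R).
Proof.
apply: cvg_near_cst; have [yx|xy] := ltP y x; near=> n.
  rewrite smooth_step_ge1// -ler_pdivrMl ?ltr0n// mulr1.
  by rewrite ltW//; near: n; apply: near_natSinv_lt; rewrite subr_gt0.
by rewrite smooth_step_le0// pmulr_rle0 ?ltr0n// subr_le0.
Unshelve. all: by end_near. Qed.

Lemma smooth_indicator_cvg (s t x : R) : s < t ->
  smooth_indicator n s t x @[n --> \oo] --> ((s < x <= t)%R%:R : R).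
Proof.
move=> st; have -> : (s < x <= t)%R%:R = (s < x)%R%:R - (t < x)%R%:R :> R.
  have [tx|xt] := ltP t x; last by rewrite andbT subr0.
  by rewrite (lt_trans st tx) subrr.
by apply: cvgB; exact: smooth_step_scaled_cvg.
Qed.

(** The derivative of the test function is a difference of mollifiers at [s] and [t], so the left
    side of the weak identity tends to [f s - f t] by continuity. The right side converges by
    dominated convergence, with bound [|g|]. *)
Lemma weak_derivative_FTC (a b s t : R) (f g : R -> R) :
  a < s -> s < t -> t < b -> {in `]a, b[, continuous f} ->
  H1_with_deriv a b f g -> f t - f s = \int[mu]_(x in `]s, t]) g x.
Proof.
move=> as_ st tb cf [f2 g2 fg].
have fi := L2_on_integrable _ _ _ f2; have gi := L2_on_integrable _ _ _ g2.
have [k [C [dk ck kC k0]]] := @smooth_step_deriv R.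
have dphi n (x : R) : is_derive x (1 : R) (smooth_indicator n s t)
    (mollifier k n s x - mollifier k n t x).
  by apply: is_deriveB; exact: is_derive_scaled_step.
have phi' n : derive1 (smooth_indicator n s t) =
    (fun x => mollifier k n s x - mollifier k n t x).
  by apply/funext => x; have d := dphi n x; rewrite derive1E derive_val.
have mphi n D : measurable_fun D (smooth_indicator n s t).
  apply: measurable_funTS; apply: continuous_measurable_fun => x.
  apply: differentiable_continuous; apply/derivable1_diffP.
  by have := dphi n x => -[].
have mab : measurable (`]a, b[%classic : set (measurableTypeR R)) by exact: measurable_itv.
have mm n y D : measurable_fun D (mollifier k n y).
  by apply: measurable_funTS; apply: continuous_measurable_fun; exact: continuous_mollifier.
have fmi n y := integrable_mul_bounded a b f _ _ fi (mm n y _) (mollifier_bound k C kC n y).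
pose J n y := \int[mu]_(x in `]a, b[) (f x * mollifier k n y x).
pose G n := \int[mu]_(x in `]a, b[) (g x * smooth_indicator n s t x).
(* Only for large [n] is the right ramp at [t] finished before [b], as an admissible test function
   requires. *)
have JG : \forall n \near \oo, - (J n s - J n t) = G n.
  near=> n.
  have tnb : t + n.+1%:R^-1 < b.
    rewrite -ltrBrDl; near: n.
    by apply: near_natSinv_lt; rewrite subr_gt0.
  have := fg _ (smooth_indicator_test_fun a b s t n as_ st tnb).
  rewrite phi' => /(congr1 fine); rewrite fineN => e.
  rewrite /J -(RintegralB _ (fmi n s) (fmi n t))//.
  rewrite /G /Rintegral -[RHS]opprK -e; congr (- fine _).
  by apply: eq_integral => x _; rewrite mulrBr.
have Jcvg y : a < y -> y < b -> J n y @[n --> \oo] --> f y.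
  move=> ay yb; apply: (mollifier_cvg k C) => //.
  by apply: cf; rewrite in_itv/= ay.
have Gcvg : G n @[n --> \oo] --> - (f s - f t).
  apply: cvg_trans; first exact: (near_eq_cvg JG).
  apply: cvgN; apply: cvgB; apply: Jcvg => //; first exact: lt_trans tb.
  exact: lt_trans st.
have gphi n := integrable_mul_bounded a b g _ _ gi (mphi n _) (smooth_indicator_le1 n s t).
have gst : measurable_fun `]a, b[ (fun x => (s < x <= t)%R%:R : R).
  apply: (measurable_fun_cvg (fun n => mphi n _)) => x _.
  exact: smooth_indicator_cvg.
have [||||| _ _] := @dominated_convergence _ _ _ mu _ mab
  (fun n x => (g x * smooth_indicator n s t x)%:E)
  (fun x => (g x * (s < x <= t)%R%:R)%:E) (fun x => `|(g x)%:E|%E).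
- by move=> n; have /measurable_int := gphi n.
- apply/measurable_EFinP; apply: measurable_funM => //.
  by case: g2.
- apply: aeW => x _; apply/fine_cvgP; split; first exact: nearW.
  by apply: cvgM; [exact: cvg_cst | exact: smooth_indicator_cvg].
- exact: integrable_abse gi.
- apply: aeW => x n _; rewrite /= lee_fin normrM ler_piMr//.
  exact: smooth_indicator_le1.
have sub_st := subset_itv_oc_oo a b s t as_ tb.
have fin : (\int[mu]_(x in `]a, b[) (g x * (s < x <= t)%R%:R)%:E)%E =
    (\int[mu]_(x in `]s, t]) g x)%:E.
  rewrite /Rintegral fineK; last first.
    by apply: integrable_fin_num => //; apply: (@integrableS _ _ _ mu _ _ _ _ _ sub_st gi).
  have -> : `]s, t]%classic = `]a, b[%classic `&` `]s, t]%classic.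
    by rewrite setIidr.
  rewrite integral_mkcondr; apply: eq_integral => x _.
  rewrite patchE; have [xst|/negP xst] := boolP (s < x <= t).
    by rewrite mem_set ?mulr1//= in_itv.
  by rewrite memNset ?mulr0//= in_itv.
rewrite fin => /fine_cvgP[_ DC].
have := cvg_unique _ Gcvg DC; rewrite opprB; apply.
exact: Rhausdorff.
Unshelve. all: by end_near. Qed.

End WeakDerivativeFTC.

(** * Energy estimates *)

Section IntegralLemmas.
Context d (T : measurableType d) (R : realType) (mu : {measure set T -> \bar R}).

(** The difference [f2 - f1] agrees almost everywhere with its absolute value, whose integral is
    nonnegative. *)
Lemma ae_le_Rintegral (D : set T) (f1 f2 : T -> R) : measurable D ->
  mu.-integrable D (EFin \o f1) -> mu.-integrable D (EFin \o f2) ->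
  {ae mu, forall x, D x -> f1 x <= f2 x} ->
  \int[mu]_(x in D) f1 x <= \int[mu]_(x in D) f2 x.
Proof.
move=> mD i1 i2 le12; rewrite -subr_ge0 -RintegralB//.
have iB : mu.-integrable D (EFin \o (fun x => f2 x - f1 x)).
  exact: (@integrableB _ _ _ mu D mD _ _ i2 i1).
have -> : \int[mu]_(x in D) (f2 x - f1 x) = \int[mu]_(x in D) `|f2 x - f1 x|.
  congr fine; apply: ae_eq_integral => //.
  - exact: measurable_int iB.
  - exact: measurable_int (integrable_norm iB).
  - by apply: filterS le12 => x h Dx; rewrite ger0_norm// subr_ge0 h.
by apply: Rintegral_ge0.
Qed.

Lemma integrable_Rsum (I : Type) (r : seq I) (D : set T) (h : I -> T -> R) :
  measurable D -> (forall i, mu.-integrable D (EFin \o h i)) ->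
  mu.-integrable D (EFin \o (fun x => \sum_(i <- r) h i x)).
Proof.
move=> mD hi; have := @integrable_sum _ _ _ mu D mD I r xpredT _ (fun i _ => hi i).
by congr (is_true (_.-integrable _ _)); apply/funext => x; rewrite /= sumEFin.
Qed.

Lemma Rintegral_sum (I : Type) (r : seq I) (D : set T) (h : I -> T -> R) :
  measurable D -> (forall i, mu.-integrable D (EFin \o h i)) ->
  \int[mu]_(x in D) (\sum_(i <- r) h i x) = \sum_(i <- r) \int[mu]_(x in D) h i x.
Proof.
move=> mD hi; elim: r => [|i r IHr].
  under eq_Rintegral do rewrite big_nil.
  by rewrite Rintegral_cst// mul0r big_nil.
under eq_Rintegral do rewrite big_cons.
by rewrite RintegralD ?IHr ?big_cons//; exact: integrable_Rsum.
Qed.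

Lemma integrable_Rscale (D : set T) (c : R) (h : T -> R) :
  measurable D -> mu.-integrable D (EFin \o h) ->
  mu.-integrable D (EFin \o (fun x => c * h x)).
Proof. by move=> mD hi; have := @integrableZl _ _ _ mu D mD c _ hi. Qed.

End IntegralLemmas.

Section Energy.
Context {R : realType}.
Notation mu := (@lebesgue_measure R).

(** Let [S] be the set of points of [[s, t]] where [H] is at most [H s]. A point of [S] close to
    [sup S] passes the bound on to points beyond [sup S], which is impossible unless [t] has been
    reached. *)
Lemma locally_nonincreasing (H : R -> R) (s t : R) : s <= t ->
  (forall x, s <= x <= t -> exists2 e, 0 < e & forall y z,
     s <= y -> y <= z -> z <= t -> `|x - y| < e -> `|x - z| < e -> H z <= H y) ->
  H t <= H s.
Proof.
move=> st loc; pose S := [set y | s <= y <= t /\ H y <= H s].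
have Ss : S s by split; rewrite ?lexx.
have supS : has_sup S.
  by split; [exists s|exists t => y [/andP[_ yt] _]].
have sc : s <= sup S by apply: ub_le_sup => //; case: supS.
have ct : sup S <= t by apply: ge_sup; [exists s|move=> y [/andP[]]].
have [e e0 he] : exists2 e, 0 < e & forall y z, s <= y -> y <= z -> z <= t ->
    `|sup S - y| < e -> `|sup S - z| < e -> H z <= H y by apply: loc; rewrite sc ct.
have [y [/andP[sy yt] Hy] cy] := sup_adherent e0 supS.
have yc : y <= sup S by apply: ub_le_sup => //; [case: supS | split; rewrite ?sy].
(* A point beyond [sup S] but within distance [e], capped at [t]; membership in [S] then forces the
   cap to be active. *)
pose z := Num.min t (sup S + e / 2).
have cz : sup S <= z by rewrite le_min ct lerDl divr_ge0// ltW.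
have zt : z <= t by rewrite ge_min lexx.
have zc : z <= sup S + e / 2 by rewrite ge_min lexx orbT.
have Hz : H z <= H s.
  apply: le_trans Hy; apply: he => //; first exact: le_trans cz.
    by rewrite ger0_norm ?subr_ge0// ltrBlDr -ltrBlDl.
  by rewrite ler0_norm ?subr_le0// opprB; lra.
have Sz : S z by split=> //; rewrite zt (le_trans sc cz).
have zc' : z <= sup S by apply: ub_le_sup => //; case: supS.
suff -> : t = z by [].
apply/eqP; rewrite eq_le zt andbT leNgt; apply/negP => zt'.
move: zc'; rewrite /z; case: (leP t (sup S + e / 2)) => h; last by lra.
by move: zt'; rewrite /z min_l// ltxx.
Qed.

Lemma energy_cvg (T : Type) (F : set_system T) (I : finType) (p : I -> R)
    (f : I -> T -> R) (l : I -> R) : Filter F ->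
  (forall i, f i x @[x --> F] --> l i) ->
  \sum_i p i * f i x ^+ 2 @[x --> F] --> \sum_i p i * l i ^+ 2.
Proof.
move=> FF fl; apply: cvg_big => [|i _]; first exact: add_continuous.
by apply: cvgM; [exact: cvg_cst | apply: cvgM].
Qed.

(** * An integral inequality for the weighted energy *)

Section EnergyEstimate.
Variables (I : finType) (f g : I -> R -> R) (p : I -> R) (a b K : R).
Hypothesis p0 : forall i, 0 <= p i.
Hypothesis cf : forall i, {in `]a, b[, continuous (f i)}.
Hypothesis gi : forall i, mu.-integrable `]a, b[ (EFin \o g i).
Hypothesis fg : forall i s t, a < s -> s < t -> t < b ->
  f i t - f i s = \int[mu]_(x in `]s, t]) g i x.

Let E x := \sum_i p i * f i x ^+ 2.

Lemma energy_continuous : {in `]a, b[, continuous E}.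
Proof.
by move=> x xab; apply: energy_cvg => i; exact: cf.
Qed.

Hypothesis fgK : {ae mu, forall x, x \in `]a, b[ ->
  \sum_i p i * (f i x * g i x) <= K * E x}.

Lemma energy_integrable s t : a < s -> s < t -> t < b ->
  mu.-integrable `]s, t] (EFin \o E).
Proof.
move=> as_ st tb; apply: (@integrableS _ _ _ mu `[s, t] _) => //.
  exact: subset_itv_oc_cc.
apply: continuous_compact_integrable; first exact: segment_compact.
apply: continuous_in_subspaceT => x /[!inE]/=; rewrite in_itv/= => /andP[sx xt].
by apply: energy_continuous; rewrite in_itv/= (lt_le_trans as_ sx) (le_lt_trans xt tb).
Qed.

(* On a short interval [f t + f s] is [2 f x] up to twice the oscillation of
   [f], so [E t - E s] is the integral of [2 f g] up to a small multiple of the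
   L1 norm of [g]; no product rule for weak derivatives is needed. *)
Let osc_estimate (e s t : R) : a < s -> s < t -> t < b ->
  (forall i x, s <= x <= t -> `|f i t - f i x| <= e /\ `|f i s - f i x| <= e) ->
  E t - E s <= \int[mu]_(x in `]s, t]) (2 * K * E x + 2 * e * \sum_i p i * `|g i x|).
Proof.
move=> as_ st tb osc.
have mst : measurable (`]s, t]%classic : set (measurableTypeR R)) by exact: measurable_itv.
have gst i : mu.-integrable `]s, t] (EFin \o g i).
  exact: (@integrableS _ _ _ mu _ _ _ _ _ (subset_itv_oc_oo a b s t as_ tb) (gi i)).
have -> : E t - E s =
    \int[mu]_(x in `]s, t]) \sum_i (p i * (f i t + f i s)) * g i x.
  rewrite Rintegral_sum//; last by move=> i; exact: integrable_Rscale.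
  rewrite /E -sumrB; apply: eq_bigr => i _.
  by rewrite RintegralZl// -fg//; ring.
apply: ae_le_Rintegral => //.
- by apply: integrable_Rsum => // i; exact: integrable_Rscale.
- apply: (@integrableD _ _ _ mu _ mst (EFin \o (fun x => 2 * K * E x))
    (EFin \o (fun x => 2 * e * \sum_i p i * `|g i x|))).
    by apply: integrable_Rscale => //; exact: energy_integrable.
  apply: integrable_Rscale => //; apply: integrable_Rsum => // i.
  by apply: integrable_Rscale => //; exact: integrable_norm.
- have aeF := ae_filter_ringOfSetsType mu; apply: filterS fgK => x h xst.
  have /h {}h : x \in `]a, b[ by exact: (subset_itv_oc_oo a b s t as_ tb).
  have {}osc i : `|f i t - f i x| <= e /\ `|f i s - f i x| <= e.
    by apply: osc; move: xst; rewrite /= in_itv/= => /andP[/ltW -> ->].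
  apply: (@le_trans _ _ (\sum_i (2 * (p i * (f i x * g i x)) +
      2 * e * (p i * `|g i x|)))).
    apply: ler_sum => i _; have [h1 h2] := osc i.
    have -> : p i * (f i t + f i s) * g i x = 2 * (p i * (f i x * g i x)) +
      p i * ((f i t - f i x + (f i s - f i x)) * g i x) by ring.
    rewrite lerD2l; have -> : 2 * e * (p i * `|g i x|) = p i * ((e + e) * `|g i x|).
      by ring.
    rewrite ler_wpM2l// (le_trans (ler_norm _))// normrM.
    by rewrite ler_wpM2r// (le_trans (ler_normD _ _))// lerD.
  rewrite big_split/= -!mulr_sumr lerD2r -mulrA ler_pM2l//.
Qed.

(** For fixed [e], the short-interval estimate says that [E] minus the integral of [Phi e] is
    locally nonincreasing, hence nonincreasing on [[s, t]]. Letting [e] tend to 0 removes the term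
    with the L1 norm of [g]. *)
Lemma energy_estimate s t : a < s -> s < t -> t < b ->
  E t - E s <= 2 * K * \int[mu]_(x in `]s, t]) E x.
Proof.
move=> as_ st tb.
have mst : measurable (`]s, t]%classic : set (measurableTypeR R)) by exact: measurable_itv.
have gst i : mu.-integrable `]s, t] (EFin \o g i).
  exact: (@integrableS _ _ _ mu _ _ _ _ _ (subset_itv_oc_oo a b s t as_ tb) (gi i)).
pose G x := \sum_i p i * `|g i x|.
have Gi : mu.-integrable `]s, t] (EFin \o G).
  apply: integrable_Rsum => // i.
  by apply: integrable_Rscale => //; exact: integrable_norm.
have Ei := energy_integrable s t as_ st tb.
pose Phi e x := 2 * K * E x + 2 * e * G x.
have Phii e : mu.-integrable `]s, t] (EFin \o Phi e).
  by apply: (@integrableD _ _ _ mu _ mst (EFin \o (fun x => 2 * K * E x))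
    (EFin \o (fun x => 2 * e * G x))); exact: integrable_Rscale.
have main e : 0 < e -> E t - E s <= 2 * K * \int[mu]_(x in `]s, t]) E x +
    2 * e * \int[mu]_(x in `]s, t]) G x.
  move=> e0; rewrite -!RintegralZl// -RintegralD//; try exact: integrable_Rscale.
  pose H z := E z - \int[mu]_(x in `]s, z]) Phi e x.
  suff : H t <= H s.
    rewrite /H set_itvoc0 Rintegral_set0 subr0; lra.
  apply: locally_nonincreasing; first exact: ltW.
  move=> x /andP[sx xt].
  have xab : x \in `]a, b[ by rewrite in_itv/= (lt_le_trans as_ sx) (le_lt_trans xt tb).
  (* Finiteness of [I] gives one neighbourhood for all [f i]; half of [e] at [x] gives oscillation
     [e] between any two nearby points. *)
  have : \forall y \near x, forall i, `|f i x - f i y| <= e / 2.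
    apply: (@filter_forall _ I (fun i y => `|f i x - f i y| <= e / 2)
      _ (nbhs_filter x)) => i.
    by have /cvgrPdist_le := cf i x xab; apply; rewrite divr_gt0.
  move=> [d /= d0 hd]; exists d => // y z sy yz zt xy xz.
  move: yz; rewrite le_eqVlt => /predU1P[->//|yz].
  rewrite /H; have -> : \int[mu]_(x in `]s, z]) Phi e x =
     \int[mu]_(x in `]s, y]) Phi e x + \int[mu]_(x in `]y, z]) Phi e x.
    rewrite -(@Rintegral_itvB _ (Phi e) (BRight s) (BRight z) y); first by ring.
    - apply: (@integrableS _ _ _ mu _ _ _ _ _ _ (Phii e)) => //.
      by apply: subset_itvl; rewrite bnd_simp.
    - by rewrite bnd_simp.
    - by rewrite bnd_simp ltW.
  suff : E z - E y <= \int[mu]_(x in `]y, z]) Phi e x by lra.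
  apply: osc_estimate => //; [exact: lt_le_trans sy|exact: le_lt_trans tb|].
  move=> i x' /andP[yx' x'z].
  have close w : y <= w <= z -> `|f i x - f i w| <= e / 2.
    move=> /andP[yw wz]; apply: hd => /=.
    move: xy xz; rewrite !ltr_norml; lra.
  have := close x'; have := close y; have := close z.
  rewrite !lexx yx' x'z (ltW yz) /= !ler_norml => /(_ isT) + /(_ isT) + /(_ isT).
  by move=> h1 h2 h3; split; lra.
set S := \int[mu]_(x in _) E x in main *; set S' := \int[mu]_(x in _) G x in main.
have S'0 : 0 <= S'.
  by apply: Rintegral_ge0 => x _; apply: sumr_ge0 => i _; rewrite mulr_ge0.
(* The parameter [e / (2 * (S' + 1))] leaves an error of [e * S' / (S' + 1)]; the added 1 keeps the
   divisor positive. *)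
apply/ler_addgt0Pr => e e0; have S1 : 0 < 2 * (S' + 1) by lra.
apply: (le_trans (main (e / (2 * (S' + 1))) _)); first exact: divr_gt0.
rewrite lerD2l; have -> : 2 * (e / (2 * (S' + 1))) * S' = e * (S' / (S' + 1)).
  by field; rewrite gt_eqF//; lra.
by rewrite ler_piMr ?(ltW e0)// ler_pdivrMr; lra.
Qed.

End EnergyEstimate.

(** Over a step of length at most [1 / (2 * K)] the energy at most doubles. Finitely many steps lead
    from any [s] near [a] to [t], so [E t <= 2 ^+ n * E s], and [E s] tends to 0 as [s] decreases to
    [a]. *)
Lemma gronwall (E : R -> R) (a b K M : R) : 0 < K ->
  (forall x, a < x < b -> 0 <= E x <= M) ->
  (forall s t, a < s -> s < t -> t < b -> mu.-integrable `]s, t] (EFin \o E)) ->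
  (forall s t, a < s -> s < t -> t < b ->
    E t - E s <= K * \int[mu]_(x in `]s, t]) E x) ->
  E x @[x --> a^'+] --> 0 -> forall t, a < t < b -> E t = 0.
Proof.
move=> K0 EM Ei EK Ea t /andP[at_ tb].
have K2 : 0 < 2 * K by rewrite mulr_gt0.
have step s t' : a < s -> s <= t' -> t' < b -> t' - s <= (2 * K)^-1 -> E t' <= 2 * E s.
  move=> as_ st' t'b sK; apply/ler_addgt0Pr => e e0.
  have M0 : 0 <= M.
    have /EM/andP[] : a < t < b by rewrite at_.
    exact: le_trans.
  (* each application of the integral inequality halves the excess over [2 * E s] *)
  have half n x : s <= x -> x <= t' -> E x <= 2 * E s + M / 2 ^+ n.
    elim: n x => [|n IHn] x sx xt'.
      have /EM/andP[_] : a < x < b by rewrite (lt_le_trans as_ sx) (le_lt_trans xt' t'b).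
      have /EM/andP[] : a < s < b by rewrite as_ (le_lt_trans st' t'b).
      rewrite expr0 divr1; lra.
    have Es0 : 0 <= E s.
      by have /EM/andP[] : a < s < b by rewrite as_ (le_lt_trans st' t'b).
    have Mn : 0 <= M / 2 ^+ n by rewrite divr_ge0// exprn_ge0.
    move: sx; rewrite le_eqVlt => /predU1P[<-|sx].
      have : 0 <= M / 2 ^+ n.+1 by rewrite divr_ge0// exprn_ge0.
      lra.
    have xb := le_lt_trans xt' t'b.
    have := EK s x as_ sx xb.
    have : \int[mu]_(y in `]s, x]) E y <= (2 * E s + M / 2 ^+ n) * (x - s).
      have -> : x - s = fine (mu `]s, x]%classic).
        by rewrite lebesgue_measure_itv/= lte_fin sx -EFinB.
      rewrite -Rintegral_cst//; apply: le_Rintegral => //.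
      - exact: Ei.
      - apply: measurable_bounded_integrable => //; last exact: bounded_cst.
        exact: lebesgue_measure_itv_lty.
      - move=> y; rewrite /= in_itv/= => /andP[sy yx].
        by apply: IHn; [exact: ltW|exact: le_trans xt'].
    set J := Rintegral _ _ _ => J1 J2.
    have xs : K * (x - s) <= 2^-1.
      rewrite -ler_pdivlMl// -invfM mulrC; apply: le_trans sK; lra.
    have : K * J <= 2^-1 * (2 * E s + M / 2 ^+ n).
      apply: (@le_trans _ _ (K * ((2 * E s + M / 2 ^+ n) * (x - s)))).
        by rewrite ler_pM2l.
      rewrite mulrCA mulrC ler_wpM2r//; lra.
    rewrite exprS invfM mulrCA; lra.
  have [n hn] : exists n, M / 2 ^+ n <= e.
    have : \forall n \near \oo, M / 2 ^+ n <= e.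
      have : M * (2^-1 : R) ^+ n @[n --> \oo] --> M * 0.
        apply: cvgM; first exact: cvg_cst.
        by apply: cvg_expr; rewrite ger0_norm ?invr_ge0// invf_lt1// ltr1n.
      rewrite mulr0 => /cvgrPdist_le/(_ e e0); apply: filterS => n.
      rewrite sub0r normrN exprVn; exact: le_trans (ler_norm _).
    by move=> [n _ hn]; exists n; apply: hn => /=.
  apply: le_trans (half n t' st' (lexx _)) _; by rewrite lerD2l.
have iter n s t' : a < s -> s <= t' -> t' < b -> t' - s <= n%:R / (2 * K) ->
    E t' <= 2 ^+ n * E s.
  elim: n s t' => [|n IHn] s t' as_ st' t'b.
    rewrite mul0r subr_le0 => t's; have -> : t' = s by apply/le_anti; rewrite t's.
    by rewrite expr0 mul1r.
  move=> ts.
  (* The last step is a full one unless it would start before [s]; the induction hypothesis covers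
     [[s, c]]. *)
  pose c := Num.max s (t' - (2 * K)^-1).
  have sc : s <= c by rewrite le_max lexx.
  have ct' : c <= t' by rewrite ge_max st' lerBlDr lerDl invr_ge0 ltW.
  apply: le_trans (step c t' _ ct' t'b _) _.
  - exact: lt_le_trans sc.
  - by rewrite lerBlDl -lerBlDr le_max lexx orbT.
  - rewrite exprS -mulrA ler_pM2l//; apply: IHn => //; first exact: le_lt_trans t'b.
    rewrite lerBlDl ge_max lerDl divr_ge0// ?(ltW K2)//=.
    move: ts; rewrite -natr1 mulrDl mul1r; lra.
(* The number of steps depends on [t - a] only, hence serves every [s] in []a, t[] at once. *)
have [n hn] : exists n, t - a <= n%:R / (2 * K).
  exists (Num.bound ((t - a) * (2 * K))).
  rewrite ler_pdivlMr// ltW//; apply: archi_boundP.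
  by rewrite mulr_ge0// ?(ltW K2)// subr_ge0 ltW.
have Et0 : 0 <= E t by have /EM/andP[] : a < t < b by rewrite at_.
apply/le_anti; rewrite Et0 andbT.
have : 2 ^+ n * E x @[x --> a^'+] --> (2 ^+ n * 0 : R).
  by apply: cvgM => //; exact: cvg_cst.
rewrite mulr0 => /cvgr_to_ge; apply; near=> s.
have as_ : a < s by near: s; exact: nbhs_right_gt.
apply: iter => //.
  by near: s; apply: nbhs_right_le.
by rewrite (le_trans _ hn)// lerD2l lerN2 ltW.
Unshelve. all: by end_near. Qed.
End Energy.

(** * The graph Laplacian *)

Section GraphAlgebra.
Variables (R : realType) (V : finType) (w : V -> V -> R) (r : R).
Implicit Types u v : V -> R.

Local Notation p i := (deg w i `^ r).

Lemma gmassB u v : gmass w r u - gmass w r v = gmass w r (fun i => u i - v i).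
Proof. by rewrite /gmass -sumrB; apply: eq_bigr => i _; rewrite mulrBl. Qed.

Lemma gbarB u v : gbar w r u - gbar w r v = gbar w r (fun i => u i - v i).
Proof. by rewrite /gbar -mulrBl gmassB. Qed.

Lemma glapB u v i : glap w r u i - glap w r v i = glap w r (fun i => u i - v i) i.
Proof.
rewrite /glap -mulrBr -sumrB; congr (_ * _); apply: eq_bigr => j _.
ring.
Qed.

(** If [u i < v i], then [u i < 1] gives [beta i >= 0] and [v i > 0] gives [gamma i <= 0], so the
    two factors have opposite signs; the other case is symmetric. *)
Lemma inB_monotone u v beta gamma i : inB u beta -> inB v gamma ->
  (u i - v i) * (beta i - gamma i) <= 0.
Proof.
move=> /(_ i)[/andP[u0 u1] ub0 ub ub1] /(_ i)[/andP[v0 v1] vb0 vb vb1].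
have le_b : 0 < u i -> beta i <= 0.
  move=> u0'; move: u1; rewrite le_eqVlt => /predU1P[/ub1//|u1'].
  by rewrite ub// u0'.
have ge_b : u i < 1 -> 0 <= beta i.
  move=> u1'; move: u0; rewrite le_eqVlt => /predU1P[/esym/ub0//|u0'].
  by rewrite ub// u0'.
have le_c : 0 < v i -> gamma i <= 0.
  move=> v0'; move: v1; rewrite le_eqVlt => /predU1P[/vb1//|v1'].
  by rewrite vb// v0'.
have ge_c : v i < 1 -> 0 <= gamma i.
  move=> v1'; move: v0; rewrite le_eqVlt => /predU1P[/esym/vb0//|v0'].
  by rewrite vb// v0'.
have [uv|uv|->] := ltrgtP (u i) (v i); last by rewrite subrr mul0r.
- rewrite mulr_le0_ge0//; first by rewrite subr_le0 ltW.
  by rewrite subr_ge0 (le_trans (le_c _) (ge_b _))// ?(le_lt_trans u0 uv)// (lt_le_trans uv).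
- rewrite mulr_ge0_le0//; first by rewrite subr_ge0 ltW.
  by rewrite subr_le0 (le_trans (le_b _) (ge_c _))// ?(le_lt_trans v0 uv)// (lt_le_trans uv).
Qed.

Section PositiveWeights.
Hypothesis w_sym : forall i j, w i j = w j i.
Hypothesis p_gt0 : forall i, 0 < p i.

Lemma weight_glap u i : p i * glap w r u i = \sum_j w i j * (u i - u j).
Proof. by rewrite /glap mulVKf// gt_eqF. Qed.

(** By symmetry of the weights, exchanging the two indices turns the double sum into its
    opposite. *)
Lemma glap_mass u : \sum_i p i * glap w r u i = 0.
Proof.
under eq_bigr do rewrite weight_glap.
set S := LHS; suff : S = - S by lra.
rewrite {1}/S exchange_big /= -sumrN; apply: eq_bigr => i _.
by rewrite -sumrN; apply: eq_bigr => j _; rewrite w_sym -mulrN opprB.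
Qed.

(** Averaging the double sum with its index-swapped copy gives half of the sum of
    [w i j * (u i - u j) ^+ 2], the Dirichlet form. *)
Lemma glap_dirichlet_ge0 u : (forall i j, 0 <= w i j) ->
  0 <= \sum_i p i * (u i * glap w r u i).
Proof.
move=> w0; under eq_bigr do rewrite mulrCA weight_glap mulr_sumr.
set S := \sum_i _; have -> : S = 2^-1 * \sum_i \sum_j w i j * (u i - u j) ^+ 2.
  have S' : S = \sum_i \sum_j u j * (w i j * (u j - u i)).
    by rewrite /S exchange_big /=; apply: eq_bigr => i _; apply: eq_bigr => j _; rewrite w_sym.
  suff : S + S = \sum_i \sum_j w i j * (u i - u j) ^+ 2 by lra.
  rewrite {2}S' /S -big_split/=; apply: eq_bigr => i _.
  by rewrite -big_split/=; apply: eq_bigr => j _; ring.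
rewrite mulr_ge0// sumr_ge0// => i _; rewrite sumr_ge0// => j _.
by rewrite mulr_ge0// sqr_ge0.
Qed.

Lemma gbar_mass u : (0 < #|V|)%N -> gbar w r u * \sum_i p i = \sum_i p i * u i.
Proof.
move=> /card_gt0P[i0 _]; have S0 : 0 < \sum_i p i.
  by rewrite (bigD1 i0)//= ltr_pwDl// sumr_ge0// => i _; rewrite ltW.
rewrite /gbar /gmass; under [X in _ / X]eq_bigr do rewrite mul1r.
by rewrite divfK ?gt_eqF//; apply: eq_bigr => i _; rewrite mulrC.
Qed.
End PositiveWeights.

(* The second alternative occurs for a single vertex and [r <> 0]: its degree
   is 0 and [0 `^ r = 0]. *)
Lemma weights_gt0_or_eq0 : (0 < #|V|)%N -> (forall i j, 0 <= w i j) ->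
  (forall i, w i i = 0) -> (forall i j, connect (fun x y => 0 < w x y) i j) ->
  (forall i, 0 < p i) \/ (forall i, p i = 0).
Proof.
move=> V0 w0 wii conn.
have deg_gt0 i j : 0 < w i j -> 0 < deg w i.
  by move=> ij; rewrite /deg (bigD1 j)//= ltr_pwDl// sumr_ge0.
have [V1|V1] := leqP #|V| 1; last first.
  left=> i; apply: powR_gt0.
  have [j ij] : exists j, j != i.
    have /card_gt1P[x [y [_ _ xy]]] := V1.
    have [xi|xi] := eqVneq x i; last by exists x.
    by exists y; rewrite -xi eq_sym.
  have /connectP[[|k q] /=] := conn i j.
    by move=> _ ji; rewrite ji eqxx in ij.
  by move=> /andP[/deg_gt0].
have V_eq (i j : V) : i = j by have /fintype_le1P/(_ j i) := V1.
have deg0 i : deg w i = 0.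
  by rewrite /deg big1// => j _; rewrite (V_eq i j) wii.
have [r0|r0] := eqVneq r 0; [left|right] => i; rewrite deg0.
  by rewrite r0 powRr0.
by rewrite powR0.
Qed.

End GraphAlgebra.

(** * Vanishing results from integral identities *)

Section IntegralFormulas.
Context {R : realType}.
Notation mu := (@lebesgue_measure R).

(** The primitive of the zero extension of [g] is locally constant on []a, b[], and almost
    everywhere its derivative is [g]. *)
Lemma ae_eq_ftc (a b : R) (g : R -> R) : mu.-integrable `]a, b[ (EFin \o g) ->
  (forall s t, a < s -> s < t -> t < b -> \int[mu]_(x in `]s, t]) g x = 0) ->
  {ae mu, forall x, a < x < b -> g x = 0}.
Proof.
move=> gi g0.
have mab : measurable (`]a, b[%classic : set (measurableTypeR R)) by exact: measurable_itv.
pose h := g \_ `]a, b[.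
have hT : mu.-integrable setT (EFin \o h).
  by rewrite -restrict_EFin; exact/(integrable_mkcond _ mab).
have hi y : mu.-integrable `]-oo, y] (EFin \o h).
  by apply: (@integrableS _ _ _ mu _ _ _ _ _ _ hT).
pose F y := \int[mu]_(t in `]-oo, y]) h t.
suff deriv0 (x : R) : derive1 F x = h x -> a < x < b -> g x = 0.
  have := FTC1Ny hi (integrable_locally mab gi).
  have aeF := ae_filter_ringOfSetsType mu; apply: filterS => x [_ Fx].
  exact: deriv0.
move=> Fx /andP[ax xb].
have -> : g x = h x by rewrite /h patchE mem_set//= in_itv/= ax.
rewrite -Fx derive1E.
have F_cst : \forall y \near x, F y = cst (F x) y.
  have Feq y z : a < y -> y < z -> z < b -> F y = F z.
    move=> ay yz zb; apply/esym/eqP; rewrite -subr_eq0 /F Rintegral_itvB//; last first.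
      by rewrite bnd_simp ltW.
    rewrite -(g0 y z ay yz zb); apply/eqP; apply: eq_Rintegral => t /set_mem tyz.
    by rewrite /h patchE mem_set//; exact: subset_itv_oc_oo tyz.
  near=> y.
  have [ay yb] : a < y /\ y < b.
    by split; near: y; [exact: lt_nbhsr|exact: lt_nbhsl].
  rewrite /cst.
  have [yx|xy|->//] := ltrgtP y x; first exact: Feq.
  by apply/esym; exact: Feq.
by rewrite (near_eq_derive _ F_cst) derive_cst.
Unshelve. all: by end_near. Qed.

Section Families.
Variables (I : finType) (f g : I -> R -> R) (p : I -> R) (a b : R).
Hypothesis gi : forall i, mu.-integrable `]a, b[ (EFin \o g i).
Hypothesis fg : forall i s t, a < s -> s < t -> t < b ->
  f i t - f i s = \int[mu]_(x in `]s, t]) g i x.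
Hypothesis fa : forall i, f i x @[x --> a^'+] --> 0.

(** Increments of the weighted sum are integrals of an almost everywhere zero function, so the sum
    is constant, equal to its limit 0 at [a]. This is used for conservation of mass. *)
Lemma weighted_sum_eq0 :
  {ae mu, forall x, a < x < b -> \sum_i p i * g i x = 0} ->
  forall t, a < t < b -> \sum_i p i * f i t = 0.
Proof.
move=> g0 t /andP[at_ tb].
have eqM s : a < s -> s < t -> \sum_i p i * f i t = \sum_i p i * f i s.
  move=> as_ st; apply/eqP; rewrite -subr_eq0 -sumrB.
  have mst : measurable (`]s, t]%classic : set (measurableTypeR R)) by exact: measurable_itv.
  have gst i : mu.-integrable `]s, t] (EFin \o g i).
    exact: (@integrableS _ _ _ mu _ _ _ _ _ (subset_itv_oc_oo a b s t as_ tb) (gi i)).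
  under eq_bigr do rewrite -mulrBr fg// -RintegralZl//.
  rewrite -Rintegral_sum//; last by move=> i; exact: integrable_Rscale.
  have sumi : mu.-integrable `]s, t] (EFin \o (fun x => \sum_i p i * g i x)).
    by apply: integrable_Rsum => // i; exact: integrable_Rscale.
  have zeroi : mu.-integrable `]s, t] (EFin \o (fun=> 0)) by exact: integrable0.
  have aeF := ae_filter_ringOfSetsType mu.
  have sum0 : {ae mu, forall x, `]s, t]%classic x -> \sum_i p i * g i x = 0}.
    apply: filterS g0 => x h xst; apply: h.
    by have := subset_itv_oc_oo a b s t as_ tb x xst; rewrite /= in_itv.
  have int0 : \int[mu]_(x in `]s, t]) 0 = 0 by rewrite Rintegral_cst ?mul0r.
  apply/eqP/le_anti; rewrite -{2 3}int0.
  by apply/andP; split; apply: ae_le_Rintegral => //; apply: filterS sum0 => x h /h ->.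
pose M x := \sum_i p i * f i x.
have M_cvg : M x @[x --> a^'+] --> \sum_i p i * (0 : R).
  apply: cvg_big => [|i _]; first exact: add_continuous.
  by apply: cvgM; [exact: cvg_cst|exact: fa].
have M_cst : M x @[x --> a^'+] --> M t.
  apply: cvg_near_cst; near=> s.
  by apply/esym; apply: eqM; near: s; [exact: nbhs_right_gt|exact: nbhs_right_lt].
have := cvg_unique _ M_cst M_cvg; rewrite big1; last by move=> i _; rewrite mulr0.
by apply; exact: Rhausdorff.
Unshelve. all: by end_near. Qed.

(** The energy inequality feeds Gronwall with constant [2 * K], the factor 2 coming from
    differentiating squares; positive weights then make each [f i] vanish with the energy. *)
Lemma energy_uniqueness (K : R) : 0 < K -> (forall i, 0 < p i) ->
  (forall i, {in `]a, b[, continuous (f i)}) ->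
  (forall i x, a < x < b -> `|f i x| <= 1) ->
  {ae mu, forall x, a < x < b ->
    \sum_i p i * (f i x * g i x) <= K * \sum_i p i * f i x ^+ 2} ->
  forall i t, a < t < b -> f i t = 0.
Proof.
move=> K0 p0 cf f1 fgK i t tab.
pose E x := \sum_i p i * f i x ^+ 2.
have p0' j : 0 <= p j by rewrite ltW.
suff /eqP : E t = 0.
  rewrite psumr_eq0; last by move=> j _; rewrite mulr_ge0 ?sqr_ge0.
  move=> /allP/(_ i); rewrite mem_index_enum => /(_ isT) /=.
  by rewrite mulf_eq0 gt_eqF//= sqrf_eq0 => /eqP.
have K2 : 0 < 2 * K by rewrite mulr_gt0.
apply: (gronwall E a b (2 * K) (\sum_i p i)) => //.
- move=> x xab; rewrite sumr_ge0/=; last by move=> j _; rewrite mulr_ge0 ?sqr_ge0.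
  apply: ler_sum => j _; rewrite ler_piMr//.
  by rewrite -real_normK ?num_real// exprn_ile1 ?f1.
- exact: energy_integrable.
- by move=> s t' as_ st tb; apply: (energy_estimate I f g p a b K).
- have -> : (0 : R) = \sum_i p i * 0 ^+ 2.
    by rewrite big1// => j _; rewrite expr0n/= mulr0.
  by apply: energy_cvg => j; exact: fa.
Qed.

End Families.
End IntegralFormulas.

(** * Comparison of two solutions *)

Section FlowDifference.
Variables (R : realType) (V : finType) (w : V -> V -> R) (r eps : R).
Variables (f g delta : V -> R).
Hypothesis V_gt0 : (0 < #|V|)%N.
Hypothesis w_sym : forall i j, w i j = w j i.
Hypothesis w_ge0 : forall i j, 0 <= w i j.
Hypothesis eps_gt0 : 0 < eps.
Hypothesis flow : forall i,
  eps * g i + eps * glap w r f i - f i + gbar w r f = delta i - gbar w r delta.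

Local Notation p i := (deg w i `^ r).

(** Solving the equation for [g], each term minus its mean has zero weighted sum, and so has the
    Laplacian. *)
Lemma flow_difference_mass : (forall i, 0 < p i) -> \sum_i p i * g i = 0.
Proof.
move=> p_gt0; have eps0 : eps != 0 by rewrite gt_eqF.
have step i : p i * g i = eps^-1 * (p i * delta i - gbar w r delta * p i)
    + eps^-1 * (p i * f i - gbar w r f * p i) - p i * glap w r f i.
  have -> : delta i = eps * g i + eps * glap w r f i - f i + gbar w r f
      + gbar w r delta by rewrite flow; ring.
  by field.
under eq_bigr do rewrite step.
rewrite big_split sumrN big_split -!mulr_sumr !sumrB -!mulr_sumr/=.
by rewrite !gbar_mass// glap_mass// !subrr !mulr0 subr0 addr0.
Qed.

(** Tested with [f], both means multiply the mass of [f], which is 0. The obstacle term is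
    nonpositive and the Dirichlet form enters with a minus sign, so only the reaction term is left
    as an upper bound. *)
Lemma flow_difference_energy : (forall i, 0 < p i) ->
  (forall i, f i * delta i <= 0) -> \sum_i p i * f i = 0 ->
  \sum_i p i * (f i * g i) <= eps^-1 * \sum_i p i * f i ^+ 2.
Proof.
move=> p_gt0 fd mass0; have eps0 : eps != 0 by rewrite gt_eqF.
have step i : p i * (f i * g i) = eps^-1 * (p i * f i ^+ 2)
    + eps^-1 * (p i * (f i * delta i)) - p i * (f i * glap w r f i)
    - eps^-1 * (gbar w r f + gbar w r delta) * (p i * f i).
  have -> : delta i = eps * g i + eps * glap w r f i - f i + gbar w r f
      + gbar w r delta by rewrite flow; ring.
  by field.
under eq_bigr do rewrite step.
rewrite sumrB -[X in _ - X <= _]mulr_sumr mass0 mulr0 subr0 sumrB big_split/=.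
rewrite -!mulr_sumr.
have lap0 := glap_dirichlet_ge0 R V w r w_sym p_gt0 f w_ge0.
have d0 : eps^-1 * (\sum_i p i * (f i * delta i)) <= 0.
  rewrite pmulr_rle0 ?invr_gt0// -oppr_ge0 -sumrN sumr_ge0// => i _.
  by rewrite oppr_ge0 pmulr_rle0.
lra.
Qed.

(* With zero weights [gbar] and [glap] vanish, since [0^-1 = 0]; the energy is
   then taken with unit weights. *)
Lemma flow_difference_energy0 : (forall i, p i = 0) ->
  (forall i, f i * delta i <= 0) ->
  \sum_i 1 * (f i * g i) <= eps^-1 * \sum_i 1 * f i ^+ 2.
Proof.
move=> p0 fd; rewrite mulr_sumr; apply: ler_sum => i _.
have gbar0 h : gbar w r h = 0.
  by rewrite /gbar /gmass big1 ?mul0r// => j _; rewrite p0 mulr0.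
have glap0 : glap w r f i = 0 by rewrite /glap p0 invr0 mul0r.
have := flow i; rewrite !gbar0 glap0 mulr0 !addr0 subr0 => e.
rewrite !mul1r -ler_pdivrMl ?invr_gt0// invrK.
have := fd i; rewrite -e; lra.
Qed.
End FlowDifference.

(** * Two solutions compared on a bounded interval *)

Section TwoSolutions.
Variables (R : realType) (V : finType) (w : V -> V -> R) (r eps b : R).
Variables (T : set R) (u beta v gamma du dv : R -> V -> R).
Notation mu := (@lebesgue_measure R).
Hypothesis V_gt0 : (0 < #|V|)%N.
Hypothesis w_sym : forall i j, w i j = w j i.
Hypothesis w_ge0 : forall i j, 0 <= w i j.
Hypothesis w_ii : forall i, w i i = 0.
Hypothesis w_conn : forall i j, connect (fun x y => 0 < w x y) i j.
Hypothesis eps_gt0 : 0 < eps.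
Hypothesis b_gt0 : 0 < b.
Hypothesis sub_T : `[0, b]%classic `<=` T.
Hypothesis uv0 : u 0 = v 0.
Hypothesis u01 : forall t, T t -> forall i, 0 <= u t i <= 1.
Hypothesis v01 : forall t, T t -> forall i, 0 <= v t i <= 1.
Hypothesis cu : forall i, {within T, continuous (fun t => u t i)}.
Hypothesis cv : forall i, {within T, continuous (fun t => v t i)}.
Hypothesis Hu : forall i, H1_with_deriv 0 b (fun t => u t i) (fun t => du t i).
Hypothesis Hv : forall i, H1_with_deriv 0 b (fun t => v t i) (fun t => dv t i).
Hypothesis uE : {ae mu, forall t, T t ->
  (forall i, eps * du t i + eps * glap w r (u t) i - u t i + gbar w r (u t)
             = beta t i - gbar w r (beta t)) /\ inB (u t) (beta t)}.
Hypothesis vE : {ae mu, forall t, T t ->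
  (forall i, eps * dv t i + eps * glap w r (v t) i - v t i + gbar w r (v t)
             = gamma t i - gbar w r (gamma t)) /\ inB (v t) (gamma t)}.

Let f i t := u t i - v t i.
Let g i t := du t i - dv t i.

Let cu3 i := (continuous_within_itvP _ b_gt0).1 (continuous_subspaceW sub_T (cu i)).
Let cv3 i := (continuous_within_itvP _ b_gt0).1 (continuous_subspaceW sub_T (cv i)).

Let cf i : {in `]0, b[, continuous (f i)}.
Proof.
move=> x xb; have [cui _ _] := cu3 i; have [cvi _ _] := cv3 i.
by apply: cvgB; [exact: cui|exact: cvi].
Qed.

Let fa i : f i x @[x --> 0^'+] --> 0.
Proof.
have [_ cui _] := cu3 i; have [_ cvi _] := cv3 i.
have h := cvgB cui cvi; rewrite uv0 subrr in h.
exact: h.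
Qed.

Let gi i : mu.-integrable `]0, b[ (EFin \o g i).
Proof.
have [_ /L2_on_integrable ui _] := Hu i; have [_ /L2_on_integrable vi _] := Hv i.
exact: (@integrableB _ _ _ mu _ (measurable_itv _) _ _ ui vi).
Qed.

Let fg i s t : 0 < s -> s < t -> t < b -> f i t - f i s = \int[mu]_(x in `]s, t]) g i x.
Proof.
move=> s0 st tb; have [cui _ _] := cu3 i; have [cvi _ _] := cv3 i.
have [_ /L2_on_integrable ui _] := Hu i; have [_ /L2_on_integrable vi _] := Hv i.
have sub := subset_itv_oc_oo 0 b s t s0 tb.
rewrite /g RintegralB//; last 2 first.
- exact: (@integrableS _ _ _ mu _ _ _ _ _ sub ui).
- exact: (@integrableS _ _ _ mu _ _ _ _ _ sub vi).
have := weak_derivative_FTC 0 b s t _ _ s0 st tb cui (Hu i).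
have := weak_derivative_FTC 0 b s t _ _ s0 st tb cvi (Hv i).
move=> <- <-; rewrite /f; ring.
Qed.

Let T_itv x : 0 < x < b -> T x.
Proof. by move=> /andP[x0 xb]; apply: sub_T; rewrite /= in_itv/= !ltW. Qed.

Let diff_flow : {ae mu, forall x, 0 < x < b -> exists delta : V -> R,
  (forall i, f i x * delta i <= 0) /\
  forall i, eps * g i x + eps * glap w r (f^~ x) i - f i x + gbar w r (f^~ x)
             = delta i - gbar w r delta}.
Proof.
have aeF := ae_filter_ringOfSetsType mu; apply: filterS2 uE vE.
move=> x ux vx /T_itv Tx; have [eu Bu] := ux Tx; have [ev Bv] := vx Tx.
exists (fun i => beta x i - gamma x i); split=> i.
  exact: inB_monotone.
rewrite -gbarB -[gbar w r (f^~ x)]gbarB -[glap w r (f^~ x) i]glapB.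
have := eu i; have := ev i; rewrite /f /g => e1 e2.
have -> : beta x i - gamma x i - (gbar w r (beta x) - gbar w r (gamma x)) =
  (beta x i - gbar w r (beta x)) - (gamma x i - gbar w r (gamma x)) by ring.
rewrite -e1 -e2; ring.
Qed.

Lemma solutions_agree_oo i t : 0 < t < b -> u t i = v t i.
Proof.
move=> tb; suff : f i t = 0 by move/eqP; rewrite subr_eq0 => /eqP.
have f1 j x : 0 < x < b -> `|f j x| <= 1.
  move=> /T_itv Tx; rewrite /f ler_norml.
  by have := u01 x Tx j; have := v01 x Tx j; lra.
have aeF := ae_filter_ringOfSetsType mu.
(* With positive weights the mass must be handled first, since the energy inequality relies on it.
   With zero weights the weighted energy would carry no information, so unit weights replace it. *)
have [p_gt0|p0] := weights_gt0_or_eq0 R V w r V_gt0 w_ge0 w_ii w_conn.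
- have mass0 : forall x, 0 < x < b -> \sum_j deg w j `^ r * f j x = 0.
    apply: (weighted_sum_eq0 V f g _ 0 b gi fg fa).
    apply: filterS diff_flow => x h /h[delta [_ fl]].
    exact: (flow_difference_mass R V w r eps (f^~ x) (g^~ x) delta).
  apply: (energy_uniqueness V f g (fun j => deg w j `^ r) 0 b gi fg fa eps^-1) => //.
    by rewrite invr_gt0.
  apply: filterS diff_flow => x h xb; have [delta [fd fl]] := h xb.
  apply: (flow_difference_energy R V w r eps (f^~ x) (g^~ x) delta) => //.
  exact: mass0.
- apply: (energy_uniqueness V f g (fun=> 1) 0 b gi fg fa eps^-1) => //.
    by rewrite invr_gt0.
  apply: filterS diff_flow => x h xb; have [delta [fd fl]] := h xb.
  exact: (flow_difference_energy0 R V w r eps (f^~ x) (g^~ x) delta).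
Qed.

Lemma solutions_agree_right i : u b i = v b i.
Proof.
have [_ _ cui] := cu3 i; have [_ _ cvi] := cv3 i.
apply/eqP; rewrite -subr_eq0; apply/eqP.
have fb : f i x @[x --> b^'-] --> u b i - v b i by exact: cvgB.
have f0 : f i x @[x --> b^'-] --> (0 : R).
  apply: cvg_near_cst; near=> x.
  rewrite /f solutions_agree_oo ?subrr//; apply/andP.
  by split; near: x; [exact: nbhs_left_gt|exact: nbhs_left_lt].
by have := cvg_unique _ fb f0; apply; exact: Rhausdorff.
Unshelve. all: by end_near. Qed.

(** Since [u] and [v] agree on the open interval, all integrals of [du - dv] over []s, t]]
    vanish. *)
Lemma solutions_deriv_agree :
  {ae mu, forall t, 0 < t < b -> forall i, du t i = dv t i}.
Proof.
have aeF := ae_filter_ringOfSetsType mu.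
have : {ae mu, forall t, forall i, 0 < t < b -> g i t = 0}.
  apply: (@filter_forall _ V (fun i t => 0 < t < b -> g i t = 0)) => i.
  apply: (ae_eq_ftc 0 b (g i)) => // s t s0 st tb.
  have tb' : 0 < t < b by rewrite tb (lt_trans s0).
  have sb' : 0 < s < b by rewrite s0 (lt_trans st).
  by rewrite -fg// /f !solutions_agree_oo// !subrr.
by apply: filterS => t h tb i; apply/eqP; rewrite -subr_eq0; apply/eqP; exact: h.
Qed.
End TwoSolutions.

(** * From bounded intervals to the whole time domain *)

(** Both shapes of [T] reduce to countably many intervals []0, bs n[] that miss at most the points 0
    and [c], so null sets can be united. For [[0, T0]] the point [c] is the right end; for the
    half-line it repeats 0. *)
Lemma time_domain_cover (R : realType) (T : set R) :
  ((exists T0 : R, 0 < T0 /\ T = `[0, T0]%classic) \/ T = `[0, +oo[%classic) ->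
  [/\ T 0, (forall t, T t -> 0 <= t), (forall t, T t -> `[0, t]%classic `<=` T) &
   exists (bs : nat -> R) (c : R), (forall n, 0 < bs n /\ T (bs n)) /\
     forall t, T t -> t != 0 -> t != c -> exists n, 0 < t < bs n].
Proof.
case=> [[T0 [T0_gt0 ->]]|->]; split.
- by rewrite /= in_itv/= lexx ltW.
- by move=> t; rewrite /= in_itv/= => /andP[].
- move=> t; rewrite /= in_itv/= => /andP[_ tT] x.
  by rewrite /= !in_itv/= => /andP[-> xt]; exact: le_trans tT.
- exists (fun=> T0), T0; split=> [n|t]; first by rewrite /= in_itv/= lexx ltW.
  rewrite /= in_itv/= => /andP[t0 tT] tn0 tnT; exists 0.
  by rewrite !lt_neqAle t0 tT tnT eq_sym tn0.
- by rewrite /= in_itv/= lexx.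
- by move=> t; rewrite /= in_itv/= => /andP[].
- by move=> t _ x; rewrite /= !in_itv/= => /andP[->].
- exists (fun n => n.+1%:R), 0; split=> [n|t].
    by rewrite /= in_itv/= ler0n ltr0n.
  rewrite /= in_itv/= andbT => t0 tn0 _; exists (Num.bound t).
  rewrite lt_neqAle t0 eq_sym tn0/=.
  by rewrite (lt_le_trans (archi_boundP t0))// ler_nat.
Qed.

Theorem theorem9 (R : realType) (V : finType) (w : V -> V -> R) (r eps : R)
  (T : set R) (u beta v gamma : R -> V -> R) :
  (0 < #|V|)%N ->
  (forall i j, w i j = w j i) ->
  (forall i j, 0 <= w i j) ->
  (forall i, w i i = 0) ->
  (forall i j, connect (fun x y => 0 < w x y) i j) ->
  0 <= r <= 1 ->
  0 < eps ->
  ((exists T0 : R, 0 < T0 /\ T = `[0, T0]%classic) \/ T = `[0, +oo[%classic) ->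
  mcDOAC_solution w r eps T u beta ->
  mcDOAC_solution w r eps T v gamma ->
  u 0 = v 0 ->
  (forall t, T t -> u t = v t) /\
  exists Tt : set R,
    [/\ Tt `<=` T,
        (@lebesgue_measure R).-negligible (T `\` Tt),
        (forall t, Tt t -> forall i,
           beta t i - gamma t i = gbar w r (beta t) - gbar w r (gamma t)) &
        (forall t, Tt t -> (exists i, 0 < u t i < 1) -> beta t = gamma t)].
Proof.
move=> V_gt0 w_sym w_ge0 w_ii w_conn r01 eps_gt0 /time_domain_cover[T_0 T_ge0 T_itv].
move=> [bs [c [bsP cover]]] [u01 cu [du [Hu uE]]] [v01 cv [dv [Hv vE]]] uv0.
pose mu := @lebesgue_measure R.
have aeF := ae_filter_ringOfSetsType mu.
have uv t : T t -> u t = v t.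
  move=> Tt; have := T_ge0 t Tt; rewrite le_eqVlt => /predU1P[<-//|t_gt0].
  apply/funext => i.
  (* Each positive [t] in [T] serves as the right end of its own interval [[0, t]], which includes
     the final time. *)
  exact: (solutions_agree_right R V w r eps t T u beta v gamma du dv
    V_gt0 w_sym w_ge0 w_ii w_conn eps_gt0 t_gt0 (T_itv t Tt) uv0 u01 v01 cu cv
    (Hu 0 t T_0 Tt) (Hv 0 t T_0 Tt) uE vE i).
have duv : {ae mu, forall t, T t -> forall i, du t i = dv t i}.
  have ae_bs : {ae mu, forall t, forall n, 0 < t < bs n -> forall i, du t i = dv t i}.
    apply/ae_foralln => n; have [bn Tbn] := bsP n.
    exact: (solutions_deriv_agree R V w r eps (bs n) T u beta v gamma du dv
      V_gt0 w_sym w_ge0 w_ii w_conn eps_gt0 bn (T_itv _ Tbn) uv0 u01 v01 cu cv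
      (Hu 0 _ T_0 Tbn) (Hv 0 _ T_0 Tbn) uE vE).
  have ae_ne (x : R) : {ae mu, forall t, t != x}.
    exists [set x]; split => //; first exact: lebesgue_measure_set1.
    by move=> t /= /negP; rewrite negbK => /eqP.
  apply: filterS3 ae_bs (ae_ne 0) (ae_ne c) => t tb t0 tc Tt.
  by have [n tn] := cover t Tt t0 tc; exact: tb tn.
split=> //.
(* These times have full measure in [T]: where both equations hold and [du = dv], the left sides
   coincide because [u = v], hence so do the right sides. *)
pose good t := [/\ T t, (forall i, beta t i - gbar w r (beta t) =
  gamma t i - gbar w r (gamma t)), inB (u t) (beta t) & inB (v t) (gamma t)].
exists good; split.
- by move=> t [].
- have : {ae mu, forall t, T t -> good t}.
    apply: filterS3 uE vE duv => t ut vt dt Tt.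
    have [eu Bu] := ut Tt; have [ev Bv] := vt Tt.
    by split=> // i; rewrite -eu -ev (dt Tt) (uv t Tt).
  by apply: negligibleS => t [Tt ngt] /(_ Tt).
- by move=> t [_ bg _ _] i; have := bg i; lra.
(* At a vertex with [0 < u t i < 1] both multipliers vanish, so the identity there equates the two
   means; at every other vertex it then equates the multipliers. *)
- move=> t [Tt bg Bu Bv] [i ui].
  have [_ _ /(_ ui) bi _] := Bu i.
  have [_ _ ci _] := Bv i; rewrite -(uv t Tt) in ci.
  have := bg i; rewrite bi (ci ui) !sub0r => /oppr_inj bar.
  by apply/funext => j; have := bg j; rewrite bar => /addIr.
Qed.
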